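(* In a square-increasing IRL $\mathbf{A}$ the following are equivalent: (i) $f^2=f$; (ii) $f\leqslant e$; (iii) $\mathbf{A}$ is idempotent. Consequently, a square-increasing IRL that is not idempotent has no idempotent subalgebra (and in particular no trivial subalgebra).
   Context: An involutive (commutative) residuated lattice (IRL) is an algebra $\langle A;\cdot,\wedge,\vee,\neg,e\rangle$ such that $\langle A;\cdot,e\rangle$ is a commutative monoid, $\langle A;\wedge,\vee\rangle$ is a lattice with order $\leqslant$, $\neg\neg x=x$, and $x\cdot y\leqslant z\iff \neg z\cdot y\leqslant\neg x$. Write $f:=\neg e$, $x^2:=x\cdot x$. It is square-increasing if $x\leqslant x^2$ for all $x$, and idempotent if $x^2=x$ for all $x$. Subalgebras are in the full signature $\cdot,\wedge,\vee,\neg,e$. *)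

(* Defs.v *)
From Stdlib Require Import ProofIrrelevance.
From mathcomp Require Import ssreflect ssrfun ssrbool.

Set Implicit Arguments.
Unset Strict Implicit.
Unset Printing Implicit Defensive.

Declare Scope irl_scope.
Delimit Scope irl_scope with irl.

(* Involutive commutative residuated lattices over an arbitrary carrier type:
   Order.latticeType would add a decidable order and a choice operator. The
   lattice is given by its equational axioms, and x <= y stands for
   meet x y = x. *)
Record IRL : Type := MkIRL {
  carrier :> Type;
  mul : carrier -> carrier -> carrier;
  meet : carrier -> carrier -> carrier;
  join : carrier -> carrier -> carrier;
  neg : carrier -> carrier;
  e : carrier;
  mulA : associative mul;
  mulC : commutative mul;
  mul1 : left_id e mul;
  meetA : associative meet;
  meetC : commutative meet;
  joinA : associative join;
  joinC : commutative join;
  meetKjoin : forall x y, meet x (join x y) = x;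
  joinKmeet : forall x y, join x (meet x y) = x;
  negK : involutive neg;
  residuation : forall x y z,
    meet (mul x y) z = mul x y <->
    meet (mul (neg z) y) (neg x) = mul (neg z) y
}.

Arguments e : clear implicits.

Definition irl_le (A : IRL) (x y : A) : Prop := meet x y = x.

Notation "x * y" := (mul x y) : irl_scope.
Notation "x <= y" := (irl_le x y) : irl_scope.
Local Open Scope irl_scope.

Definition f (A : IRL) : A := neg (e A).

Definition square_increasing (A : IRL) : Prop := forall x : A, x <= x * x.

Definition idempotent_irl (A : IRL) : Prop := idempotent_op (@mul A).

Definition trivial_irl (A : IRL) : Prop := forall x y : A, x = y.

Record subuniverse (A : IRL) : Type := MkSubuniverse {
  mem :> A -> Prop;
  mem_mul : forall x y, mem x -> mem y -> mem (x * y);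
  mem_meet : forall x y, mem x -> mem y -> mem (meet x y);
  mem_join : forall x y, mem x -> mem y -> mem (join x y);
  mem_neg : forall x, mem x -> mem (neg x);
  mem_e : mem (e A)
}.

Section Subalgebra.
Variables (A : IRL) (B : subuniverse A).

Let T := {x : A | B x}.

Let T_inj (u v : T) : sval u = sval v -> u = v.
Proof. by case: u v => [x Bx] [y By] /= eq_xy; apply: subset_eq_compat. Qed.

Definition sub_mul (u v : T) : T :=
  exist _ (sval u * sval v) (mem_mul (svalP u) (svalP v)).
Definition sub_meet (u v : T) : T :=
  exist _ (meet (sval u) (sval v)) (mem_meet (svalP u) (svalP v)).
Definition sub_join (u v : T) : T :=
  exist _ (join (sval u) (sval v)) (mem_join (svalP u) (svalP v)).
Definition sub_neg (u : T) : T :=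
  exist _ (neg (sval u)) (mem_neg (svalP u)).
Definition sub_e : T := exist _ (e A) (mem_e B).

Fact sub_mulA : associative sub_mul.
Proof. by move=> u v w; apply: T_inj; apply: mulA. Qed.
Fact sub_mulC : commutative sub_mul.
Proof. by move=> u v; apply: T_inj; apply: mulC. Qed.
Fact sub_mul1 : left_id sub_e sub_mul.
Proof. by move=> u; apply: T_inj; apply: mul1. Qed.
Fact sub_meetA : associative sub_meet.
Proof. by move=> u v w; apply: T_inj; apply: meetA. Qed.
Fact sub_meetC : commutative sub_meet.
Proof. by move=> u v; apply: T_inj; apply: meetC. Qed.
Fact sub_joinA : associative sub_join.
Proof. by move=> u v w; apply: T_inj; apply: joinA. Qed.
Fact sub_joinC : commutative sub_join.
Proof. by move=> u v; apply: T_inj; apply: joinC. Qed.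
Fact sub_meetKjoin u v : sub_meet u (sub_join u v) = u.
Proof. by apply: T_inj; apply: meetKjoin. Qed.
Fact sub_joinKmeet u v : sub_join u (sub_meet u v) = u.
Proof. by apply: T_inj; apply: joinKmeet. Qed.
Fact sub_negK : involutive sub_neg.
Proof. by move=> u; apply: T_inj; apply: negK. Qed.
Fact sub_residuation u v w :
  sub_meet (sub_mul u v) w = sub_mul u v <->
  sub_meet (sub_mul (sub_neg w) v) (sub_neg u) = sub_mul (sub_neg w) v.
Proof.
have [resl resr] := residuation (sval u) (sval v) (sval w).
by split=> /(congr1 sval) h; apply: T_inj; [apply: resl | apply: resr].
Qed.

Definition subalgebra : IRL :=
  MkIRL sub_mulA sub_mulC sub_mul1 sub_meetA sub_meetC sub_joinA sub_joinC
    sub_meetKjoin sub_joinKmeet sub_negK sub_residuation.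

End Subalgebra.

(* Main.v *)
Require Import Defs.
From mathcomp Require Import ssreflect ssrfun ssrbool.
Local Open Scope irl_scope.

(** Residuation gives [x * neg x <= f], and [x * x <= x] iff
    [neg x * x <= neg x]. If [f <= e], then
    [neg x * x <= neg x * (neg x * x) <= neg x * f <= neg x], the first step by
    square-increase and monotonicity. Conversely, [f * f <= f] residuates to
    [e * f <= e]. As [f] lies in every subalgebra,
    an idempotent subalgebra already forces [f * f = f]. *)

(** The two absorption laws make [meet] idempotent. *)
Lemma irl_le_refl {A : IRL} (x : A) : x <= x.
Proof. by rewrite /irl_le -{2}(joinKmeet x x) meetKjoin. Qed.

Lemma irl_le_trans {A : IRL} {y x z : A} : x <= y -> y <= z -> x <= z.
Proof. by rewrite /irl_le => xy yz; rewrite -{1}xy -meetA yz. Qed.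

Lemma irl_le_anti {A : IRL} (x y : A) : x <= y -> y <= x -> x = y.
Proof. by rewrite /irl_le => xy yx; rewrite -xy meetC. Qed.

Lemma mul_le_iff {A : IRL} (x y z : A) : x * y <= z <-> neg z * y <= neg x.
Proof. exact: residuation. Qed.

Lemma neg_le {A : IRL} (x y : A) : x <= y <-> neg y <= neg x.
Proof. by have := mul_le_iff x (e A) y; rewrite !(mulC _ (e A)) !mul1. Qed.

(** Residuation turns the goal into [neg (y * z) * z <= neg x]. The left side is below [neg y] by
    residuating [y * z <= y * z], and [neg] reverses [x <= y]. *)
Lemma mul_le2r {A : IRL} {z x y : A} : x <= y -> x * z <= y * z.
Proof.
move=> xy; apply/mul_le_iff/(irl_le_trans (y := neg y));
  last by apply: (proj1 (neg_le x y)).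
by apply: (proj1 (mul_le_iff y z (y * z))); apply: irl_le_refl.
Qed.

Lemma mul_le2l {A : IRL} {z x y : A} : x <= y -> z * x <= z * y.
Proof. by rewrite !(mulC z _); apply: mul_le2r. Qed.

Lemma neg_mul_le_f {A : IRL} (x : A) : neg x * x <= f A.
Proof. by apply/(mul_le_iff (e A) x x); rewrite mul1; apply: irl_le_refl. Qed.

Lemma f_idem_le_e {A : IRL} : f A * f A = f A -> f A <= e A.
Proof.
move=> ff; have /mul_le_iff : f A * f A <= f A by rewrite ff; apply: irl_le_refl.
by rewrite /f !negK mul1.
Qed.

Lemma f_le_e_idempotent {A : IRL} :
  square_increasing A -> f A <= e A -> idempotent_irl A.
Proof.
move=> hA fe x; apply: irl_le_anti; last exact: hA.
apply/mul_le_iff/(irl_le_trans (y := neg x * (neg x * x))).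
  by rewrite mulA; apply/mul_le2r/hA.
(* Writing the right-hand [neg x] as [neg x * e] leaves [neg x * x <= e] by monotonicity. *)
rewrite -{3}(mul1 (neg x)) (mulC (e A)); apply: mul_le2l.
exact: irl_le_trans (neg_mul_le_f x) fe.
Qed.

Lemma idempotent_subalgebra {A : IRL} (B : subuniverse A) :
  square_increasing A -> idempotent_irl (subalgebra B) -> idempotent_irl A.
Proof.
move=> hA idB; apply/f_le_e_idempotent/f_idem_le_e => //.
(* The projection of [f (subalgebra B)] to [A] computes to [f A]. *)
by have /(congr1 (@sval _ _)) := idB (f (subalgebra B)).
Qed.

Theorem theorem3p3 (A : IRL) (hA : square_increasing A) :
  (f A * f A = f A <-> f A <= e A) /\
  (f A <= e A <-> idempotent_irl A) /\
  (~ idempotent_irl A ->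
     (~ exists B : subuniverse A, idempotent_irl (subalgebra B)) /\
     (~ exists B : subuniverse A, trivial_irl (subalgebra B))).
Proof.
split; first by split=> [/f_idem_le_e | /(f_le_e_idempotent hA)].
split; first by split=> [/(f_le_e_idempotent hA) //| idA]; apply: f_idem_le_e.
(* A trivial subalgebra is idempotent, so one argument covers both cases. *)
move=> nidA; split=> -[B hB]; apply/nidA/(idempotent_subalgebra B) => //.
Qed.
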